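(* Let $\mathcal{A}$ be an alphabet with $|\mathcal{A}|\ge 2$, let $x\ge 1$, $y\ge 2$ and $c\ge x$ be integers, and suppose that $\mathcal{F}$ is a universal partial quasi-family for $\mathcal{A}^x$ satisfying all of the following conditions: (a) every member of $\mathcal{F}$ has length either $c$ or $c|\mathcal{A}|$; (b) at least one member of $\mathcal{F}$ has length $c$ and at least one member of $\mathcal{F}$ has length $c|\mathcal{A}|$; (c) every member of $\mathcal{F}$ with length $c$ has exactly one $\diamond$ in every $x$-window, and at least one member of $\mathcal{F}$ with length $c|\mathcal{A}|$ has exactly one $\diamond$ in every $x$-window. Then there exist a universal partial family $\mathcal{G}$ for $\mathcal{A}^x$, with members of common length $L$, and an unrolled alternating De Bruijn cycle $\mathcal{W}$ of order $2y+1$ for the alphabet pair $(\mathcal{G},\{0,\ldots,L-1\})$, such that $m(\mathcal{W})$ is a universal partial torus for $\mathcal{A}^{(y+1)\times x}$ without well-defined diamondicity.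
   Context: An alphabet $\mathcal{A}$ is a finite nonempty set, and $\diamond\notin\mathcal{A}$ is a wildcard symbol. A cyclic partial word over $\mathcal{A}$ is a cyclic sequence over $\mathcal{A}\cup\{\diamond\}$. An $x$-window of it is a sequence of $x$ consecutive symbols (read cyclically). It covers a word $v$ at position $i$ if $v$ is obtained from the $|v|$-window starting at index $i$ by replacing each $\diamond$ by some letter of $\mathcal{A}$ (independently for different places). A universal partial quasi-family (UPQF) for $\mathcal{A}^{x}$ is a set of cyclic partial words over $\mathcal{A}$ such that every word in $\mathcal{A}^x$ is covered by exactly one element of the set, and is covered exactly once (at exactly one position) in that element; the elements may have different lengths. A universal partial family (upfamily) for $\mathcal{A}^x$ is a UPQF all of whose elements have the same length. An alternating word of length $2n+1$ on an alphabet pair $(\mathcal{X},\mathcal{Y})$ is a word in $\mathcal{X}\times\mathcal{Y}\times\mathcal{X}\times\cdots\times\mathcal{Y}\times\mathcal{X}$ with $2n+1$ factors. An alternating De Bruijn cycle of order $2n+1$ on $(\mathcal{X},\mathcal{Y})$ is a cyclic word, with entries alternately in $\mathcal{X}$ and $\mathcal{Y}$, that contains every alternating word of length $2n+1$ on $(\mathcal{X},\mathcal{Y})$ exactly once; it has length $2|\mathcal{X}|^{n+1}|\mathcal{Y}|^n$. If $f_0r_0f_1r_1\cdots f_{v-1}r_{v-1}$ (with $f_i\in\mathcal{X}$, $r_i\in\mathcal{Y}$) is an alternating De Bruijn cycle, then $f_0r_0f_1r_1\cdots f_{v-1}r_{v-1}f_v$ with $f_v=f_0$ is an unrolled alternating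 De Bruijn cycle of the same order. Fix a linear representation of each element of the upfamily $\mathcal{G}$. Let $\sigma(c_0c_1\cdots c_{k-1})=c_1\cdots c_{k-1}c_0$ be forward rotation. For $\mathcal{W}=f_0r_0f_1r_1\cdots r_{v-1}f_v$ with $f_i\in\mathcal{G}$ and $r_j\in\{0,\ldots,L-1\}$, put $\phi_0=f_0$ and $\phi_n=\sigma^{\sum_{i=0}^{n-1}r_i}(f_n)$ for $1\le n\le v$. Then $m(\mathcal{W})$ is the matrix with rows $\phi_0,\ldots,\phi_{v-1}$, considered cyclically in both directions. A partial torus over $\mathcal{A}$ is a matrix with entries in $\mathcal{A}\cup\{\diamond\}$ whose row and column indices are both read cyclically. Its $w\times\ell$ windows are its $w\times\ell$ arrays of consecutive rows and columns (read cyclically). It covers $P\in\mathcal{A}^{w\times\ell}$ (matrices over $\mathcal{A}$ with $w$ rows and $\ell$ columns) at a position if $P$ is obtained from the window with top-left corner at that position by replacing each $\diamond$ by some letter of $\mathcal{A}$. A universal partial torus (uptorus) for $\mathcal{A}^{w\times\ell}$ is a partial torus over $\mathcal{A}$ that covers every matrix in $\mathcal{A}^{w\times\ell}$ exactly once. It has well-defined diamondicity if all its $w\times\ell$ windows contain the same number of $\diamond$'s. *)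

(* Defs.v *)
From mathcomp Require Import all_boot all_algebra.
From mathcomp Require Import generic_quotient finmap.

Set Implicit Arguments.
Unset Strict Implicit.
Unset Printing Implicit Defensive.

Local Open Scope quotient_scope.
Local Open Scope fset_scope.

(* The index k steps after i in the cyclic order of 'I_n: (i + k) mod n. *)
Definition cshift n (i : 'I_n) (k : nat) : 'I_n := iter k (@ordS n) i.

Section CyclicWords.

Variable A : finType.

(* Partial symbols are [option A]; the wildcard is [None]. *)
Definition is_rot (s t : seq (option A)) : bool :=
  [exists k : 'I_(size s).+1, rot k s == t].

Lemma is_rotP s t : reflect (exists k, rot k s = t) (is_rot s t).
Proof.
apply: (iffP existsP) => [[k /eqP <-]|[k <-]]; first by exists k.
have lt_k : minn k (size s) < (size s).+1 by rewrite ltnS geq_minr.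
by exists (Ordinal lt_k); rewrite /= -rot_minn.
Qed.

Lemma is_rot_refl : reflexive is_rot.
Proof. by move=> s; apply/is_rotP; exists 0; rewrite rot0. Qed.

Lemma is_rot_sym : symmetric is_rot.
Proof.
have sub s t : is_rot s t -> is_rot t s.
  case/is_rotP=> k <-; apply/is_rotP; exists (size (rot k s) - k).
  exact: rotK.
by move=> s t; apply/idP/idP; apply: sub.
Qed.

Lemma is_rot_trans : transitive is_rot.
Proof.
move=> t s u /is_rotP [k <-] /is_rotP [l <-]; apply/is_rotP.
by exists (rot_add s k l); rewrite rot_rot_add.
Qed.

Canonical is_rot_equiv :=
  EquivRel is_rot is_rot_refl is_rot_sym is_rot_trans.

(* Cyclic partial words: sequences up to rotation.  The linear representations
   of g are the sequences s with [\pi_(cword) s = g]. *)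
Definition cword := {eq_quot is_rot_equiv}.

(* A word starts with some representative chosen by [repr]; a different choice
   only renumbers the positions cyclically. *)
Definition csize (g : cword) : nat := size (repr g).

Definition cwindow (x : nat) (g : cword) (i : nat) : seq (option A) :=
  [seq nth None (repr g) ((i + j) %% csize g) | j <- iota 0 x].

Definition fills (a : A) (o : option A) : bool :=
  if o is Some b then a == b else true.

Definition covers_at (x : nat) (g : cword) (v : x.-tuple A) (i : 'I_(csize g))
    : bool :=
  all2 fills v (cwindow x g i).

Definition covers (x : nat) (g : cword) (v : x.-tuple A) : Prop :=
  exists i : 'I_(csize g), covers_at v i.

Definition upqf (x : nat) (F : {fset cword}) : Prop :=
  forall v : x.-tuple A,
    (exists! g : cword, g \in F /\ covers g v) /\
    (forall g : cword, g \in F -> covers g v ->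
       exists! i : 'I_(csize g), covers_at v i).

Definition upfamily (x L : nat) (G : {fset cword}) : Prop :=
  upqf x G /\ (forall g : cword, g \in G -> csize g = L).

Definition one_diamond (x : nat) (g : cword) : Prop :=
  forall i : 'I_(csize g), count_mem None (cwindow x g i) = 1.

End CyclicWords.

Section Alternating.

Variables X Y : Type.

(* f_0 r_0 f_1 ... r_(n-1) f_n, of length 2n+1. *)
Record altword (n : nat) := AltWord {
  altx : n.+1.-tuple X;
  alty : n.-tuple Y
}.

(* The cyclic word f_0 r_0 ... f_(v-1) r_(v-1) is given by its v consecutive
   pairs (f_i, r_i); [i] is the pair at which the window starts. *)
Definition occurs_at (n v : nat) (C : v.-tuple (X * Y)) (P : altword n)
    (i : 'I_v) : Prop :=
  (forall j : 'I_n.+1, (tnth C (cshift i j)).1 = tnth (altx P) j) /\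
  (forall j : 'I_n, (tnth C (cshift i j)).2 = tnth (alty P) j).

(* An alternating De Bruijn cycle of order 2n+1 (not n). *)
Definition alt_debruijn (n v : nat) (C : v.-tuple (X * Y)) : Prop :=
  forall P : altword n, exists! i : 'I_v, occurs_at C P i.

Definition rolled (v : nat) (W : altword v) : v.-tuple (X * Y) :=
  [tuple (tnth (altx W) (widen_ord (leqnSn v) i), tnth (alty W) i) | i < v].

Definition unrolled_alt_debruijn (n v : nat) (W : altword v) : Prop :=
  tnth (altx W) ord_max = tnth (altx W) ord0 /\ alt_debruijn n (rolled W).

End Alternating.

Section PartialTorus.

Variable A : finType.

Definition twindow (w l p q : nat) (M : 'M[option A]_(p, q))
    (i : 'I_p) (j : 'I_q) : 'M[option A]_(w, l) :=
  \matrix_(a < w, b < l) M (cshift i a) (cshift j b).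

Definition tcovers_at (w l p q : nat) (M : 'M[option A]_(p, q))
    (P : 'M[A]_(w, l)) (ij : 'I_p * 'I_q) : Prop :=
  forall (a : 'I_w) (b : 'I_l), fills (P a b) (twindow w l M ij.1 ij.2 a b).

Definition uptorus (w l p q : nat) (M : 'M[option A]_(p, q)) : Prop :=
  forall P : 'M[A]_(w, l), exists! ij : 'I_p * 'I_q, tcovers_at M P ij.

Definition diamonds (w l : nat) (P : 'M[option A]_(w, l)) : nat :=
  #|[set ab : 'I_w * 'I_l | P ab.1 ab.2 == None]|.

Definition well_defined_diamondicity (w l p q : nat) (M : 'M[option A]_(p, q))
    : Prop :=
  forall (i i' : 'I_p) (j j' : 'I_q),
    diamonds (twindow w l M i j) = diamonds (twindow w l M i' j').

End PartialTorus.

Section Torus.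

Variables (A : finType) (G : {fset cword A}) (L : nat).
Variable rep : cword A -> seq (option A).

Definition linear_repr : Prop :=
  forall g : cword A, g \in G -> \pi_(cword A) (rep g) = g.

Definition phi (v : nat) (W : altword G 'I_L v) (n : 'I_v.+1)
    : seq (option A) :=
  iter (\sum_(i < v | i < n) tnth (alty W) i) (rot 1)
       (rep (val (tnth (altx W) n))).

(* The rows phi_0, ..., phi_(v-1) have length L when all members of G do. *)
Definition torus_of (v : nat) (W : altword G 'I_L v) : 'M[option A]_(v, L) :=
  \matrix_(i < v, j < L) nth None (phi W (widen_ord (leqnSn v) i)) j.

End Torus.

(* Main.v *)
Require Import Defs.
From mathcomp Require Import all_boot all_fingroup all_algebra finmap.
From mathcomp Require Import generic_quotient.

(** The family G is obtained from F by stretching its short members.  If g has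
    length c and exactly one wildcard in every x-window, concatenate |A| copies
    of g and replace the wildcards of the k-th copy by the k-th letter.  A word
    covered by g at position i is then covered at exactly one of the |A|
    positions congruent to i modulo c, because the single wildcard of that
    window receives each letter once.  So every stretched word covers the same
    words as the original, each still once, and all lengths are now
    L = c * |A| ([tiles_unfolded]).  The stretched words have no wildcard,
    while by hypothesis some long member of F, which is kept as it is, has one
    in every x-window.

    For such a G every alternating De Bruijn cycle of order 2y+1 with y >= 2
    gives a universal torus.  Row number i of the torus is f_i rotated by the
    sum S_i of the preceding r's.  Each of the y+1 rows of a given matrix P is
    covered by a unique g_a in G at a unique position p_a modulo L, so P is
    covered at (i, j) exactly when f_(i+a) = g_a and S_(i+a) + j = p_a modulo L
    for all a.  Taking differences, this says that the alternating word
    g_0 (p_1 - p_0) g_1 ... g_y occurs at i and that j = p_0 - S_i: there is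
    one such i by the De Bruijn property and one such j
    ([torus_universal]).  For windows that wrap around vertically this needs
    the sum of all r's to vanish modulo L, which holds because in an
    alternating De Bruijn cycle the letters r_0 and r_1 of a block are
    independent when y >= 2 ([sum_alt_debruijn]).

    Alternating De Bruijn cycles exist because they are Euler circuits of a
    balanced connected digraph; the circuit is found by joining the cycles of a
    permutation of the edges ([euler_circuit]).  Finally, the words
    g 0 g 0 ... g for g stretched and for g long with wildcards occur in the
    cycle, and the corresponding windows of the torus have no wildcard and some
    wildcards respectively. *)

Set Implicit Arguments.
Unset Strict Implicit.
Unset Printing Implicit Defensive.

(** * Euler circuits and alternating De Bruijn cycles *)

Section Euler.

Variables (T : finType) (V : eqType) (src : T -> V).

(** Here [T] is the set of edges of a digraph and [src] gives their sources; a
    permutation [s0] that sends each edge to one starting where it ends exists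
    exactly when the digraph is balanced.  Such a permutation decomposes the
    edges into closed walks.  Take one with the fewest closed walks: if two
    edges with the same target were on different walks, exchanging their
    successors would merge these walks.  So walks that meet are equal, and
    connectedness leaves a single one. *)
Lemma euler_circuit (s0 : {perm T}) :
  (forall e e', connect [rel d d' | src d' == src (s0 d)] e e') ->
  exists2 s : {perm T}, forall e, src (s e) = src (s0 e)
                      & forall e e', e' \in porbit s e.
Proof.
move=> conn.
pose walk (s : {perm T}) := [forall e, src (s e) == src (s0 e)].
have walk_s0 : walk s0 by apply/forallP.
case: (arg_minnP (fun s : {perm T} => #|porbits s|) walk_s0).
move=> s /forallP ws min_s.
have src_s e : src (s e) = src (s0 e) by apply/eqP.
(* Composing with a transposition of d and d' merges their distinct orbits. *)
have merge d d' : src (s d) = src (s d') -> d \in porbit s d'.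
  move=> eq_dd'; apply: contraT => out_d.
  have ne_dd' : d != d' by apply: contraNneq out_d => ->; exact: porbit_id.
  have wt : walk (tperm d d' * s)%g.
    apply/forallP=> e; rewrite permM -src_s.
    by case: tpermP => [->|->|//]; rewrite eq_dd'.
  have := porbits_mul_tperm s d d'; rewrite /= out_d ne_dd' /= => card_t.
  have := min_s _ wt; rewrite -(leq_add2r 1) -card_t.
  by rewrite leq_add2l.
exists s => // e e'; case/connectP: (conn e e') => p.
elim: p e => [|d p IHp] e /=; first by move=> _ ->; exact: porbit_id.
case/andP=> /eqP ed /IHp{}IHp /IHp.
(* The edge before d on its walk has the same target as e. *)
suff : d \in porbit s e by rewrite -eq_porbit_mem => /eqP <-.
have /merge : src (s (s^-1%g d)) = src (s e) by rewrite permKV ed src_s.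
rewrite -!eq_porbit_mem => /eqP <-.
by rewrite -[d in porbit s d](permKV s) eq_sym -(porbit_perm s 1) expg1.
Qed.

End Euler.

Lemma cshiftE n (i : 'I_n) k : cshift i k = (i + k) %% n :> nat.
Proof.
elim: k => [|k IHk]; first by rewrite addn0 modn_small.
by rewrite /cshift iterS /= -/(cshift i k) IHk -addn1 modnDml -addnA addn1.
Qed.

(** A sequence of words that overlap when shifted by one is the sequence of
    windows of a single infinite word, that of their initial letters. *)
Lemma shifted_words (Z : Type) n (u : nat -> {ffun 'I_n.+1 -> Z}) :
    (forall k (j : 'I_n),
       u k.+1 (widen_ord (leqnSn n) j) = u k (lift ord0 j)) ->
  forall k j, u k j = u (k + j) ord0.
Proof.
move=> step k [j lt_j]; elim: j k lt_j => [|j IHj] k lt_j /=.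
  by rewrite addn0; congr (u k _); apply: val_inj.
rewrite addnS -addSn -(IHj k.+1 (ltnW lt_j)).
have -> : Ordinal lt_j = lift ord0 (Ordinal (lt_j : j < n)) by exact: val_inj.
by rewrite -step; congr (u k.+1 _); apply: val_inj.
Qed.

Section DeBruijn.

Variables X Y : finType.

(** Alternating words encoded by finite functions, so that they form a [finType]
    that can be counted and summed over. *)
Definition block n := ({ffun 'I_n.+1 -> X} * {ffun 'I_n -> Y})%type.

Definition cycle_block n v (C : v.-tuple (X * Y)) (i : 'I_v) : block n :=
  ([ffun j : 'I_n.+1 => (tnth C (cshift i j)).1],
   [ffun j : 'I_n => (tnth C (cshift i j)).2]).

Lemma occurs_at_block n v (C : v.-tuple (X * Y)) (P : altword X Y n) i :
  occurs_at C P i <->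
  cycle_block n C i =
    ([ffun j => tnth (altx P) j], [ffun j => tnth (alty P) j]).
Proof.
split=> [[Px Py]|[/ffunP Px /ffunP Py]].
  by congr pair; apply/ffunP=> j; rewrite !ffunE ?Px ?Py.
by split=> j; [have := Px j | have := Py j]; rewrite !ffunE.
Qed.

Lemma alt_debruijn_bij n v (C : v.-tuple (X * Y)) :
  alt_debruijn n C <-> bijective (cycle_block n C).
Proof.
pose word (E : block n) :=
  AltWord [tuple E.1 j | j < n.+1] [tuple E.2 j | j < n].
have wordE E i : occurs_at C (word E) i <-> cycle_block n C i = E.
  rewrite occurs_at_block; have -> // :
    ([ffun j => tnth (altx (word E)) j],
     [ffun j => tnth (alty (word E)) j]) = E.
  by case: E => E1 E2; congr pair; apply/ffunP=> j; rewrite ffunE tnth_mktuple.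
split=> [dbC|[g gK Kg] P].
  apply: inj_card_bij => [i i' eq_ii'|].
    have [k [_ k_uniq]] := dbC (word (cycle_block n C i)).
    by rewrite -(k_uniq i) ?(k_uniq i') //; apply/wordE.
  apply: leq_trans (leq_image_card (cycle_block n C) _).
  apply/subset_leq_card/subsetP=> E _.
  by have [i [/wordE <- _]] := dbC (word E); apply: image_f.
exists (g ([ffun j => tnth (altx P) j], [ffun j => tnth (alty P) j])).
by split=> [|i]; rewrite occurs_at_block ?Kg // => <-; rewrite gK.
Qed.

(** The edges of the digraph are the blocks of order n+1; a block may follow
    another one when it extends the latter with its first f and r removed.
    Cyclic rotation of blocks is a permutation showing that this digraph is
    balanced, and reading the letters of one block and then those of another
    gives a walk between them. *)
Lemma alt_debruijn_exists n (a0 : X) (b0 : Y) :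
  exists v (W : altword X Y v), unrolled_alt_debruijn n.+1 W.
Proof.
pose E : finType := block n.+1.
pose src (e : E) := ([ffun j : 'I_n.+1 => e.1 (widen_ord (leqnSn _) j)],
                     [ffun j : 'I_n => e.2 (widen_ord (leqnSn _) j)]).
pose dst (e : E) := ([ffun j : 'I_n.+1 => e.1 (lift ord0 j)],
                     [ffun j : 'I_n => e.2 (lift ord0 j)]).
pose turn (e : E) : E := ([ffun j => e.1 (ordS j)], [ffun j => e.2 (ordS j)]).
have turn_inj : injective turn.
  move=> [e1 e2] [d1 d2] [/ffunP eq1 /ffunP eq2].
  by congr pair; apply/ffunP=> j;
    [have := eq1 (ord_pred j) | have := eq2 (ord_pred j)];
    rewrite !ffunE ord_predK.
have ordS_widen m (j : 'I_m) : ordS (widen_ord (leqnSn m) j) = lift ord0 j.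
  by apply: val_inj; rewrite /= modn_small // ltnS.
have src_turn e : src (perm turn_inj e) = dst e.
  by rewrite permE; congr pair; apply/ffunP=> j; rewrite !ffunE ordS_widen.
pose win (f : nat -> X) (r : nat -> Y) k : E :=
  ([ffun j : 'I_n.+2 => f (k + j)], [ffun j : 'I_n.+1 => r (k + j)]).
have src_win f r k : src (win f r k.+1) = dst (win f r k).
  by congr pair; apply/ffunP=> j; rewrite !ffunE /= /bump /= addSnnS.
have conn_win f r k :
    connect [rel d d' | src d' == src (perm turn_inj d)]
      (win f r 0) (win f r k).
  elim: k => [|k IHk]; first exact: connect0.
  by apply: connect_trans IHk (connect1 _); rewrite /= src_turn src_win.
have conn e e' : connect [rel d d' | src d' == src (perm turn_inj d)] e e'.
  (* The letter r_(n+1), between e and e', is arbitrary. *)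
  pose f k := if k < n.+2 then e.1 (inord k) else e'.1 (inord (k - n.+2)).
  pose r k := if k < n.+1 then e.2 (inord k) else e'.2 (inord (k - n.+2)).
  have -> : e = win f r 0.
    case: (e) @f @r => e1 e2 f r; congr pair; apply/ffunP=> j;
    by rewrite ffunE /f /r add0n ltn_ord inord_val.
  have -> : e' = win f r n.+2.
    case: (e') @f @r => e1 e2 f r; congr pair; apply/ffunP=> j; rewrite ffunE.
      by rewrite /f ltnNge leq_addr addKn inord_val.
    by rewrite /r ltnNge (leq_trans (leqnSn _)) ?leq_addr //= addKn inord_val.
  exact: conn_win.
have [s src_s all_s] := euler_circuit conn.
pose e0 : E := ([ffun=> a0], [ffun=> b0]); pose e k := iter k s e0.
have orbT : porbit s e0 = [set: E] by apply/setP=> d; rewrite inE all_s.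
pose v := #|E|; have period : e v = e0.
  by rewrite /e /v -cardsT -orbT iter_porbit.
have e_mod k : e (k %% v) = e k.
  rewrite {2}(divn_eq k v) addnC /e iterD; congr iter.
  by elim: (k %/ v) => //= m IHm; rewrite mulSn iterD -IHm -/(e v).
have step k : src (e k.+1) = dst (e k) by rewrite src_s src_turn.
pose f k := (e k).1 ord0; pose r k := (e k).2 ord0.
(* Along the circuit, the block reached after k steps consists of the initial
   letters of the blocks reached after k, k+1, ... steps. *)
have eE k : e k = win f r k.
  rewrite [LHS]surjective_pairing; congr pair; apply/ffunP=> j; rewrite ffunE.
    apply: (shifted_words (u := fun l => (e l).1)) => l i.
    by have [/ffunP/(_ i)] := step l; rewrite !ffunE.
  apply: (shifted_words (u := fun l => (e l).2)) => l i.
  by have [_ /ffunP/(_ i)] := step l; rewrite !ffunE.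
have f_mod k : f (k %% v) = f k by rewrite /f e_mod.
have r_mod k : r (k %% v) = r k by rewrite /r e_mod.
exists v, (AltWord [tuple f i | i < v.+1] [tuple r i | i < v]); split.
  by rewrite /= !tnth_mktuple /f period.
apply/alt_debruijn_bij; set C := rolled _.
have C_e (i : 'I_v) : cycle_block n.+1 C i = e i.
  rewrite eE; congr pair; apply/ffunP=> j;
  by rewrite !ffunE !tnth_mktuple /= cshiftE ?f_mod ?r_mod.
apply: inj_card_bij => [i i'|]; last by rewrite card_ord.
rewrite !C_e => eq_ii'; apply: val_inj => /=; apply/eqP.
have := uniq_traject_porbit s e0; rewrite orbT cardsT -/v => /nth_uniq uniq_e.
rewrite -(uniq_e e0 i i') ?size_traject ?ltn_ord // !nth_traject ?ltn_ord //.
exact/eqP.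
Qed.

(** The sum runs over the first r of every block.  Split it according to the
    second r: permuting the values of the second r identifies the #|Y| parts
    with each other, so their common value occurs #|Y| times. *)
Lemma sum_alt_debruijn n v (C : v.-tuple (X * Y)) (h : Y -> nat) :
  alt_debruijn n.+2 C -> #|Y| %| \sum_(i < v) h (tnth C i).2.
Proof.
move/alt_debruijn_bij=> bijC.
have -> : \sum_(i < v) h (tnth C i).2 = \sum_(e : block n.+2) h (e.2 ord0).
  rewrite (reindex (cycle_block n.+2 C)) /=; last exact: onW_bij.
  by apply: eq_bigr => i _; rewrite ffunE.
pose j1 : 'I_n.+2 := lift ord0 ord0.
rewrite (partition_big (fun e : block n.+2 => e.2 j1) predT) //=.
have [b0 _ | Y0] := pickP Y; last by rewrite big1 // => b; have := Y0 b.
rewrite (eq_bigr (fun=> \sum_(e : block n.+2 | e.2 j1 == b0) h (e.2 ord0)));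
  last first.
  move=> b _.
  pose swap (e : block n.+2) : block n.+2 :=
    (e.1, [ffun j => if j == j1 then tperm b b0 (e.2 j) else e.2 j]).
  have swapK : involutive swap.
    case=> e1 e2; congr pair; apply/ffunP=> j; rewrite !ffunE.
    by case: eqP => // _; rewrite tpermK.
  rewrite (reindex_inj (inv_inj swapK)) /=; apply: eq_big => e.
    by rewrite ffunE eqxx -(inj_eq (@perm_inj _ (tperm b b0))) tpermK tpermL.
  by rewrite !ffunE.
by rewrite sum_nat_const dvdn_mulr.
Qed.

End DeBruijn.

(** * Reading partial words cyclically *)

Section CyclicReading.

Variable A : finType.
Implicit Types (s t : seq (option A)) (g : cword A).

Definition cyc s i := nth None s (i %% size s).

Lemma cyc_small s i : i < size s -> cyc s i = nth None s i.
Proof. by move=> lt_i; rewrite /cyc modn_small. Qed.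

Lemma cyc_rot1 s i : cyc (rot 1 s) i = cyc s i.+1.
Proof.
rewrite /cyc size_rot; case: s => [|a s]; first by rewrite !nth_nil.
rewrite rot1_cons nth_rcons /= -[i.+1]addn1 -modnDml addn1.
have := ltn_pmod i (ltn0Sn (size s)); rewrite ltnS leq_eqVlt.
case/predU1P=> [-> | lt_i]; first by rewrite ltnn eqxx modnn.
by rewrite lt_i [(_.+1) %% _]modn_small.
Qed.

Lemma cyc_iter_rot1 k s i : cyc (iter k (rot 1) s) i = cyc s (i + k).
Proof.
by elim: k i => [|k IHk] i; rewrite ?addn0 //= cyc_rot1 IHk addSnnS.
Qed.

Lemma size_iter_rot1 k s : size (iter k (rot 1) s) = size s.
Proof. by elim: k => //= k IHk; rewrite size_rot. Qed.

Lemma is_rot_size s t : is_rot s t -> size s = size t.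
Proof. by case/is_rotP=> k <-; rewrite size_rot. Qed.

Lemma is_rot_cyc s t :
  is_rot s t -> exists k, forall i, cyc t i = cyc s (i + k).
Proof.
case/is_rotP=> k <-; rewrite rot_minn; have := geq_minr k (size s).
move: (minn _ _) => {}k le_k; exists k => i; rewrite -cyc_iter_rot1; congr cyc.
by elim: k le_k => [|k IHk] lt_k; rewrite ?rot0 // rotS // IHk // ltnW.
Qed.

(** Covering with positions in [nat], meant modulo [size s]: unlike [covers_at],
    it makes sense for any linear representation, and a rotation of [s] only
    translates the positions. *)
Definition covers_from x s (v : x.-tuple A) i : Prop :=
  forall b : 'I_x, fills (tnth v b) (cyc s (i + b)).

Lemma covers_atE x g (v : x.-tuple A) (i : 'I_(csize g)) :
  covers_at v i <-> covers_from (repr g) v i.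
Proof.
have all2_map T S1 S2 (f : S1 -> S2 -> bool) (h : T -> S1) (k : T -> S2) r :
  all2 f (map h r) (map k r) = all (fun z => f (h z) (k z)) r.
  by elim: r => //= z r ->.
rewrite /covers_at /cwindow -val_enum_ord -map_comp -map_tnth_enum all2_map.
split=> [/allP cov_b b | cov_b]; first by apply: cov_b; rewrite mem_enum.
by apply/allP=> b _; apply: cov_b.
Qed.

(** The defining property of a universal partial quasi-family, for a family of
    words [u] indexed by [F].  The indexing leaves the choice of linear
    representations free. *)
Definition tiles (I : choiceType) x (F : {fset I}) (u : I -> seq (option A)) :=
  forall v : x.-tuple A,
    (exists2 e, e \in F & exists i, covers_from (u e) v i) /\
    (forall e e' i i', e \in F -> e' \in F ->
       covers_from (u e) v i -> covers_from (u e') v i' ->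
       e = e' /\ i = i' %[mod size (u e)]).

Lemma covers_from_mod x s (v : x.-tuple A) i :
  covers_from s v (i %% size s) <-> covers_from s v i.
Proof. by split=> cov_i b; have := cov_i b; rewrite /cyc modnDml. Qed.

(** Nonempty words are required: [covers_from] also holds at positions of the
    empty word, where [covers] has no position to offer. *)
Lemma upqf_tiles x (F : {fset cword A}) :
  (forall g, g \in F -> 0 < csize g) ->
  upqf x F <-> tiles x F (fun g => repr g).
Proof.
move=> F_gt0; split=> [qF v | tF v].
  have covE g i : g \in F -> covers_from (repr g) v i ->
      exists i' : 'I_(csize g), i' = i %% csize g :> nat /\ covers_at v i'.
    move=> Fg /covers_from_mod cov_i.
    exists (Ordinal (ltn_pmod i (F_gt0 g Fg))).
    by split; last apply/covers_atE.
  have [[g [[Fg [i cov_i]] g_uniq]] i_uniq] := qF v; split.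
    by exists g => //; exists i; apply/covers_atE.
  move=> h h' k k' Fh Fh' cov_h cov_h'.
  have [[j [def_j cov_j]] [j' [def_j' cov_j']]] :=
    (covE _ _ Fh cov_h, covE _ _ Fh' cov_h').
  have eq_hh' : h = h'.
    by rewrite -(g_uniq h) ?(g_uniq h') //; split=> //; [exists j' | exists j].
  split=> //; case: h' / eq_hh' Fh' cov_h' j' def_j' cov_j'.
  move=> Fh' _ j' def_j' cov_j'.
  have [|o [_ o_uniq]] := i_uniq h Fh; first by exists j.
  rewrite -/(csize h) -def_j -def_j'.
  by rewrite -(o_uniq j) ?(o_uniq j').
have [[g Fg [i cov_i]] uniq_v] := tF v; split=> [|h Fh [j cov_j]].
  exists g; split=> [|h [Fh [j /covers_atE cov_j]]].
    split=> //; exists (Ordinal (ltn_pmod i (F_gt0 g Fg))).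
    exact/covers_atE/covers_from_mod.
  by have [] := uniq_v _ _ _ _ Fg Fh cov_i cov_j.
exists j; split=> // j' /covers_atE cov_j'; apply: val_inj.
move/covers_atE: cov_j => cov_j.
by have [_] := uniq_v _ _ _ _ Fh Fh cov_j cov_j'; rewrite !modn_small.
Qed.

(** Rotations only translate the positions.  Members of [F] with the same image
    under [T] cover the same words, so the uniqueness for [F] identifies them as
    soon as they cover one. *)
Lemma tiles_rot (I J : choiceType) x (F : {fset I}) u
    (T : I -> J) (u' : J -> seq (option A)) :
  (forall e, e \in F -> is_rot (u e) (u' (T e))) ->
  tiles x F u -> tiles x (T @` F)%fset u'.
Proof.
move=> rotF tF v; have [[e Fg [i cov_i]] uniq_v] := tF v; split.
  exists (T e); first exact: in_imfset.
  have := rotF e Fg; rewrite is_rot_sym => /is_rot_cyc[k uE].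
  by exists (i + k) => b; rewrite addnAC -uE.
move=> _ _ i1 i2 /imfsetP[e1 /= Fg1 ->] /imfsetP[e2 /= Fg2 ->] cov1 cov2.
have pull (d : I) j k : (forall i, cyc (u' (T d)) i = cyc (u d) (i + k)) ->
    covers_from (u' (T d)) v j -> covers_from (u d) v (j + k).
  by move=> uE cov b; rewrite addnAC -uE.
have [k1 /pull pull1] := is_rot_cyc (rotF _ Fg1).
have [k2 /pull pull2] := is_rot_cyc (rotF _ Fg2).
have [eq_g _] := uniq_v _ _ _ _ Fg1 Fg2 (pull1 _ cov1) (pull2 _ cov2).
rewrite -{e2}eq_g in Fg2 cov2 pull2 *; split=> //.
have [_ /eqP] := uniq_v _ _ _ _ Fg1 Fg1 (pull1 _ cov1) (pull1 _ cov2).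
by rewrite eqn_modDr (is_rot_size (rotF _ Fg1)) => /eqP.
Qed.

(** * Stretching words with one wildcard per window *)

Definition one_hole x s :=
  forall i, exists2 b : 'I_x, cyc s (i + b) = None
                            & forall b' : 'I_x, cyc s (i + b') = None -> b' = b.

Lemma one_diamond_hole x g :
  0 < csize g -> one_diamond x g -> one_hole x (repr g).
Proof.
move=> g_gt0 hole_g i.
have /eqP := hole_g (Ordinal (ltn_pmod i g_gt0)).
rewrite /cwindow -val_enum_ord -map_comp count_map -size_filter /=.
pose hole (b : 'I_x) := cyc (repr g) (i + b) == None.
have inF b : (b \in [seq b <- enum 'I_x | hole b]) = hole b.
  by rewrite mem_filter mem_enum andbT.
rewrite (eq_filter (a2 := hole)); last first.
  by move=> b; rewrite /hole /= modnDml.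
case: filter inF => [|b [|//]] // inF _.
exists b => [|b' b'N]; first by apply/eqP; rewrite -/(hole b) -inF mem_head.
by apply/eqP; rewrite -mem_seq1 inF /hole b'N.
Qed.

(** #|A| copies of [s], the wildcards of the k-th copy being replaced by the
    k-th letter; the default value [None] of [nth] is never reached. *)
Definition unfold_holes s : seq (option A) :=
  mkseq (fun q => if cyc s q is Some a then Some a
                  else nth None (map Some (enum A)) (q %/ size s))
        (size s * #|A|).

Lemma size_unfold_holes s : size (unfold_holes s) = size s * #|A|.
Proof. exact: size_mkseq. Qed.

Lemma cyc_unfold_holes s q : 0 < size s * #|A| ->
  cyc (unfold_holes s) q =
    if cyc s q is Some a then Some a
    else nth None (map Some (enum A)) ((q %% (size s * #|A|)) %/ size s).
Proof.
move=> sA_gt0; rewrite /cyc size_unfold_holes nth_mkseq ?ltn_pmod //.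
by rewrite /cyc modn_dvdm // dvdn_mulr.
Qed.

Lemma unfold_holes_total s q :
  0 < size s * #|A| -> cyc (unfold_holes s) q <> None.
Proof.
move=> sA_gt0; rewrite cyc_unfold_holes //; case: cyc => // nthN.
have /andP[s_gt0 _] : (0 < size s) && (0 < #|A|) by rewrite -muln_gt0.
have lt_k : (q %% (size s * #|A|)) %/ size s < size (map Some (enum A)).
  by rewrite size_map -cardE ltn_divLR // mulnC ltn_pmod // mulnC.
have : None \in map Some (enum A) by rewrite -nthN mem_nth.
by case/mapP.
Qed.

Lemma covers_unfold_holes x s (v : x.-tuple A) i : 0 < size s * #|A| ->
  covers_from (unfold_holes s) v i -> covers_from s v i.
Proof.
by move=> sA_gt0 cov b; move: (cov b); rewrite cyc_unfold_holes //; case: cyc.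
Qed.

(** At both positions the wildcard of the window is at the same place and is
    replaced by the same letter, hence lies in the same copy of [s]. *)
Lemma unfold_holes_unique x s (v : x.-tuple A) i i' :
    0 < size s * #|A| -> one_hole x s ->
    covers_from (unfold_holes s) v i -> covers_from (unfold_holes s) v i' ->
  i = i' %[mod size s] -> i = i' %[mod size (unfold_holes s)].
Proof.
move=> sA_gt0 hole_s cov cov' eq_ii'.
have /andP[s_gt0 _] : (0 < size s) && (0 < #|A|) by rewrite -muln_gt0.
have [b bN _] := hole_s i.
have eq_b : i + b = i' + b %[mod size s] by rewrite -modnDml eq_ii' modnDml.
have b'N : cyc s (i' + b) = None by rewrite /cyc -eq_b.
move: (cov b) (cov' b); rewrite !cyc_unfold_holes // bN b'N {bN b'N}.
set k := (_ %/ _); set k' := (_ %/ _) => cov_k cov_k'.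
have lt_A q : (q %% (size s * #|A|)) %/ size s < size (enum A).
  by rewrite -cardE ltn_divLR // mulnC ltn_pmod // mulnC.
have eq_k : k = k'.
  have [lt_k lt_k'] := (lt_A (i + b), lt_A (i' + b)).
  apply/eqP; rewrite -(nth_uniq (tnth v b) lt_k lt_k' (enum_uniq A)).
  move: cov_k cov_k'; rewrite (nth_map (tnth v b) _ _ lt_k).
  rewrite (nth_map (tnth v b) _ _ lt_k') /=.
  by move=> /eqP <- /eqP <-.
apply/eqP; rewrite size_unfold_holes -(eqn_modDr b); apply/eqP.
rewrite (divn_eq ((i + b) %% _) (size s)) (divn_eq ((i' + b) %% _) (size s)).
by rewrite -/k -/k' eq_k !modn_dvdm ?dvdn_mulr // eq_b.
Qed.

(** The window is moved to the copy of [s] in which its wildcard has become the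
    letter of [v] at that place. *)
Lemma unfold_holes_exists x s (v : x.-tuple A) i :
    0 < size s * #|A| -> one_hole x s -> covers_from s v i ->
  exists i', covers_from (unfold_holes s) v i'.
Proof.
move=> sA_gt0 hole_s cov.
have /andP[s_gt0 A_gt0] : (0 < size s) && (0 < #|A|) by rewrite -muln_gt0.
have [b bN b_uniq] := hole_s i.
pose k := index (tnth v b) (enum A).
have lt_k : k < #|A| by rewrite cardE index_mem mem_enum.
pose t := (i + b) %% size s + size s * k.
have lt_t : t < size s * #|A|.
  rewrite -(leq_pmul2l s_gt0) in lt_k; apply: leq_trans lt_k.
  by rewrite mulnS ltn_add2r ltn_pmod.
(* The wildcard goes to index t; the multiple of the length keeps the
   subtraction of b from truncating. *)
pose i' := t + (size s * #|A| * b - b).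
have i'b : i' + b = t + b * (size s * #|A|).
  by rewrite -addnA subnK ?leq_pmull // [in RHS]mulnC.
have eq_ii' : i' = i %[mod size s].
  apply/eqP; rewrite -(eqn_modDr b) i'b /t mulnCA -addnA -mulnDr mulnC.
  by rewrite [_ * size s]mulnC addnC mulnC modnMDl modn_mod.
exists i' => b'; rewrite cyc_unfold_holes //.
have cyc_b' : cyc s (i' + b') = cyc s (i + b').
  by rewrite /cyc -modnDml eq_ii' modnDml.
case def_b': (cyc s (i' + b')) => [a|].
  by have := cov b'; rewrite -cyc_b' def_b'.
have -> : b' = b by apply: b_uniq; rewrite -cyc_b'.
rewrite i'b [t + _]addnC modnMDl modn_small // /t addnC mulnC divnMDl //.
rewrite divn_small ?ltn_pmod // addn0.
by rewrite (nth_map (tnth v b)) -?cardE // nth_index ?mem_enum /=.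
Qed.

End CyclicReading.

(** * Windows of the torus *)

Section TorusWindows.

Variables (A : finType) (G : {fset cword A}) (L v : nat).
Variables (rep : cword A -> seq (option A)) (W : altword G 'I_L v).
Hypothesis size_rep : forall g, g \in G -> size (rep g) = L.

Let C := rolled W.

Definition offset (i : nat) : nat := \sum_(l < v | l < i) tnth (alty W) l.

(** The row after the last one is the first one, with offset 0: this is where
    the total of the r's has to vanish modulo [L]. *)
Lemma offset_ordS (i : 'I_v) :
  L %| \sum_(l < v) (tnth C l).2 ->
  offset (ordS i) = offset i + (tnth C i).2 %[mod L].
Proof.
have next : offset i.+1 = offset i + (tnth C i).2.
  rewrite /offset (bigD1 i) //= addnC tnth_mktuple /=; congr (_ + _).
  by apply: eq_bigl => l; rewrite ltnS [RHS]ltn_neqAle andbC.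
move=> dvd_sum; have := ltn_ord i; rewrite leq_eqVlt => /predU1P[last_i|lt_i].
  have total : offset v = \sum_(l < v) (tnth C l).2.
    by apply: eq_big => l *; rewrite ?ltn_ord // tnth_mktuple.
  rewrite -next last_i total (eqP dvd_sum) /= last_i modnn.
  by rewrite /offset big_pred0 // mod0n.
by rewrite -next /= [i.+1 %% v]modn_small.
Qed.

Lemma torus_entry (i : 'I_v) (j : 'I_L) :
  torus_of rep W i j = cyc (rep (val (tnth C i).1)) (offset i + j).
Proof.
rewrite mxE /phi -/(offset i) tnth_mktuple /=.
rewrite -cyc_small; first by rewrite cyc_iter_rot1 addnC.
by rewrite size_iter_rot1 size_rep ?fsvalP.
Qed.

Lemma torus_window w x (i : 'I_v) (j : 'I_L) (a : 'I_w) (b : 'I_x) :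
  twindow w x (torus_of rep W) i j a b =
    cyc (rep (val (tnth C (cshift i a)).1)) (offset (cshift i a) + j + b).
Proof.
rewrite mxE torus_entry /cyc size_rep ?fsvalP //.
by rewrite (cshiftE j) modnDmr addnA.
Qed.

Lemma torus_covers w x (P : 'M[A]_(w, x)) (i : 'I_v) (j : 'I_L) :
  tcovers_at (torus_of rep W) P (i, j) <->
  forall a : 'I_w, covers_from (rep (val (tnth C (cshift i a)).1))
                     [tuple P a b | b < x] (offset (cshift i a) + j).
Proof.
split=> cov a b; first by rewrite tnth_mktuple -torus_window.
by have := cov a b; rewrite tnth_mktuple -torus_window.
Qed.

(** A window with top-left corner [(k, j)] covers [P] exactly when the word [Q]
    made of the members covering the rows of [P] and of the differences of their
    positions occurs at [k], and the first row is positioned correctly. *)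
Lemma torus_universal x y :
  0 < L ->
  tiles x G rep -> alt_debruijn y C -> L %| \sum_(l < v) (tnth C l).2 ->
  uptorus y.+1 x (torus_of rep W).
Proof.
move=> L_gt0 tG dbC dvd_sum P.
have /fin_all_exists[h hP] (a : 'I_y.+1) : exists gp : G * nat,
    covers_from (rep (val gp.1)) [tuple P a b | b < x] gp.2.
  have [[g Gg [p cov_p]] _] := tG [tuple P a b | b < x].
  by exists ([` Gg]%fset, p).
pose g a := (h a).1; pose p a := (h a).2.
have h_uniq a (k : G) q : covers_from (rep (val k)) [tuple P a b | b < x] q <->
    k = g a /\ q = p a %[mod L].
  split=> [cov_q|[-> eq_q]].
    have [_ uniq_a] := tG [tuple P a b | b < x].
    have [] := uniq_a _ _ _ _ (fsvalP k) (fsvalP (g a)) cov_q (hP a).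
    move/val_inj=> ->.
    by rewrite size_rep ?fsvalP.
  apply/covers_from_mod; rewrite size_rep ?fsvalP // eq_q.
  by rewrite -(size_rep (fsvalP (g a))); apply/covers_from_mod/hP.
have negK o : o + (L - o %% L) = 0 %[mod L].
  by rewrite -modnDml subnKC ?modnn ?mod0n // ltnW ?ltn_pmod.
(* Positions are indexed by nat so that p' k.+1 makes sense; p' is only used
   up to y. *)
pose p' (k : nat) := p (inord k).
have p'E (a : 'I_y.+1) : p' a = p a by rewrite /p' inord_val.
pose diff k : 'I_L := Ordinal (ltn_pmod (p' k.+1 + (L - p' k %% L)) L_gt0).
have diffE k : p' k + diff k = p' k.+1 %[mod L].
  by rewrite /= modnDmr addnCA -modnDmr negK mod0n addn0.
pose Q := AltWord [tuple g a | a < y.+1] [tuple diff a | a < y].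
have occE (k : 'I_v) : occurs_at C Q k <->
    (forall a : 'I_y.+1, (tnth C (cshift k a)).1 = g a) /\
    (forall a : 'I_y, (tnth C (cshift k a)).2 = diff a).
  by split=> -[e1 e2]; split=> a; rewrite ?e1 ?e2 tnth_mktuple.
have stepE (k : 'I_v) a j : offset (cshift k a.+1) + j =
    offset (cshift k a) + j + (tnth C (cshift k a)).2 %[mod L].
  rewrite -[cshift k a.+1]/(ordS (cshift k a)) -modnDml.
  by rewrite offset_ordS // modnDml addnAC.
have key (k : 'I_v) (j : 'I_L) : tcovers_at (torus_of rep W) P (k, j) <->
    occurs_at C Q k /\ offset k + j = p' 0 %[mod L].
  rewrite torus_covers occE; split=> [cov | [[g_k d_k] o_k] a].
    have {}cov a := (h_uniq _ _ _).1 (cov a).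
    have eq_p a : a < y.+1 -> offset (cshift k a) + j = p' a %[mod L].
      by move=> lt_a; rewrite (cov (Ordinal lt_a)).2 -p'E.
    split; last exact: eq_p 0 _.
    split=> a; first exact: (cov a).1.
    apply: val_inj; rewrite -[LHS](modn_small (ltn_ord _)).
    rewrite -[RHS](modn_small (ltn_ord _)).
    apply/eqP; rewrite -(eqn_modDl (p' a)) diffE -(eq_p a.+1) ?ltnS //.
    by rewrite stepE -modnDml -eq_p ?modnDml // ltnW // ltnS.
  apply/h_uniq; split; rewrite ?g_k // -p'E.
  case: a => a lt_a /=; elim: a lt_a => [|a IHa] lt_a //.
  rewrite stepE -modnDml IHa ?(ltnW lt_a) // modnDml.
  by rewrite (d_k (Ordinal (lt_a : a < y))) diffE.
have [i [occ_i i_uniq]] := dbC Q.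
have lt_j : (p' 0 + (L - offset i %% L)) %% L < L by rewrite ltn_pmod.
exists (i, Ordinal lt_j); split=> [|[k j] /key[/i_uniq <- eq_j]].
  apply/key; split=> //.
  by rewrite /= modnDmr addnCA -modnDmr negK mod0n addn0.
congr pair; apply: val_inj => /=; rewrite -modnDml -eq_j modnDml addnAC.
by rewrite -modnDml negK mod0n add0n modn_small.
Qed.

End TorusWindows.

(** * The universal partial torus *)

Section Unfolding.

Variables (A : finType) (x c : nat) (F : {fset cword A}).
Hypothesis cA_gt0 : 0 < c * #|A|.
Hypothesis short_hole : forall g, g \in F -> csize g = c -> one_hole x (repr g).

Definition unfolded (g : cword A) : seq (option A) :=
  if csize g == c then unfold_holes (repr g) else repr g.

Lemma tiles_unfolded : tiles x F (fun g => repr g) -> tiles x F unfolded.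
Proof.
move=> tF v; have [[g Fg [i cov_i]] uniq_v] := tF v; split.
  exists g => //; rewrite /unfolded; case: eqP => [sz_g|_]; last by exists i.
  apply: (@unfold_holes_exists _ _ _ _ i) => //; last exact: short_hole.
  by rewrite -/(csize g) sz_g.
have fold e k : covers_from (unfolded e) v k -> covers_from (repr e) v k.
  rewrite /unfolded; case: eqP => // sz_e.
  by apply: covers_unfold_holes; rewrite -/(csize e) sz_e.
move=> e e' k k' Fe Fe' cov_e cov_e'.
have [eq_e eq_k] := uniq_v _ _ _ _ Fe Fe' (fold _ _ cov_e) (fold _ _ cov_e').
rewrite -{e'}eq_e in Fe' cov_e' *; split=> //.
move: cov_e cov_e'; rewrite /unfolded; case: eqP => // sz_e cov_e cov_e'.
apply: unfold_holes_unique cov_e cov_e' eq_k; last exact: short_hole.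
by rewrite -/(csize e) sz_e.
Qed.

End Unfolding.

Theorem theorem9p3 (A : finType) (x y c : nat) (F : {fset cword A}) :
  1 < #|A| -> 1 <= x -> 2 <= y -> x <= c ->
  upqf x F ->
  (forall g : cword A, g \in F -> csize g = c \/ csize g = c * #|A|) ->
  (exists g : cword A, g \in F /\ csize g = c) ->
  (exists g : cword A, g \in F /\ csize g = c * #|A|) ->
  (forall g : cword A, g \in F -> csize g = c -> one_diamond x g) ->
  (exists g : cword A, [/\ g \in F, csize g = c * #|A| & one_diamond x g]) ->
  exists (L : nat) (G : {fset cword A}),
    upfamily x L G /\
    forall rep : cword A -> seq (option A), linear_repr G rep ->
      exists (v : nat) (W : altword G 'I_L v),
        [/\ unrolled_alt_debruijn y W,
            uptorus y.+1 x (torus_of rep W) &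
            ~ well_defined_diamondicity y.+1 x (torus_of rep W)].
Proof.
move=> A_gt1 x_gt0 y_ge2 le_xc qF sizeF [g0 [Fg0 sz_g0]] _ holeF.
move=> [h [Fh sz_h hole_h]].
have c_gt0 : 0 < c := leq_trans x_gt0 le_xc.
have L_gt0 : 0 < c * #|A| by rewrite muln_gt0 c_gt0 ltnW.
have F_gt0 g : g \in F -> 0 < csize g by case/sizeF=> ->.
have short_hole g : g \in F -> csize g = c -> one_hole x (repr g).
  by move=> Fg sz_g; apply: one_diamond_hole; [apply: F_gt0 | apply: holeF].
pose T g : cword A := (\pi_(cword A) (unfolded c g))%qT.
pose G := (T @` F)%fset; pose L := c * #|A|.
have tu : tiles x F (unfolded c).
  by apply: tiles_unfolded => //; apply/upqf_tiles.
have rotT rep g :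
  linear_repr G rep -> g \in F -> is_rot (unfolded c g) (rep (T g)).
  move=> repG Fg; apply/(eqmodP (is_rot_equiv A)).
  exact/esym/(repG (T g))/in_imfset.
have size_u g : g \in F -> size (unfolded c g) = L.
  rewrite /unfolded; case: eqP => [sz_g _ | long_g /sizeF[]//].
  by rewrite size_unfold_holes -/(csize g) sz_g.
have sizeG rep g : linear_repr G rep -> g \in G -> size (rep g) = L.
  move=> repG /imfsetP[e /= Fe ->].
  by rewrite -(is_rot_size (rotT _ _ repG Fe)) size_u.
have tG rep : linear_repr G rep -> tiles x G rep.
  by move=> repG; apply: tiles_rot tu => g Fg; apply: rotT.
have reprG : linear_repr G (fun g => repr g) by move=> g _; exact: reprK.
exists L, G; split=> [|rep repG].
  split=> [|g Gg]; last exact: sizeG reprG Gg.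
  apply/upqf_tiles => [g Gg|]; last exact: tG.
  by rewrite /csize (sizeG _ _ reprG Gg).
have GT g : g \in F -> T g \in G by move=> Fg; apply: in_imfset.
case: y y_ge2 => [|[|y]] // _.
pose r0 : 'I_L := Ordinal L_gt0.
have [v [W WdB]] := alt_debruijn_exists y.+1 [` GT _ Fg0]%fset r0.
have sizeR g : g \in G -> size (rep g) = L by exact: sizeG.
have dbW := WdB.2; exists v, W; split=> //.
  apply: torus_universal => //; first exact: tG.
  by have := sum_alt_debruijn (@nat_of_ord L) dbW; rewrite card_ord.
(* The rows of the window at i are all copies of the single member T g. *)
have const g : g \in F -> exists (i : 'I_v) (k : nat -> nat), forall a b,
    twindow y.+3 x (torus_of rep W) i r0 a b = cyc (unfolded c g) (k a + b).
  move=> Fg; have [k rotE] := is_rot_cyc (rotT _ _ repG Fg).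
  have [i [[occ_i _] _]] :=
    dbW (AltWord [tuple [` GT _ Fg]%fset | _ < y.+3] [tuple r0 | _ < y.+2]).
  exists i, (fun a => offset W (cshift i a) + r0 + k) => a b.
  by rewrite torus_window // occ_i tnth_mktuple rotE addnAC.
have [i0 [k0 win0]] := const _ Fg0; have [i1 [k1 win1]] := const _ Fh.
move=> /(_ i0 i1 r0 r0).
have -> : diamonds (twindow y.+3 x (torus_of rep W) i0 r0) = 0.
  apply/eqP; rewrite cards_eq0; apply/eqP/setP=> -[a b]; rewrite !inE win0 /=.
  apply/eqP; rewrite /unfolded sz_g0 eqxx.
  by apply: unfold_holes_total; rewrite -/(csize g0) sz_g0.
have [b bN _] := one_diamond_hole (F_gt0 _ Fh) hole_h (k1 0).
apply/eqP; rewrite eq_sym cards_eq0; apply/set0Pn; exists (ord0, b).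
rewrite inE win1 /unfolded ifF ?bN // sz_h.
by rewrite -{2}[c]muln1 eqn_pmul2l // gtn_eqF.
Qed.
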